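(* Let $\xi_1,\xi_2\in\,]0,1[\,\setminus\{\tfrac12\}$ be such that $\xi_1\not\equiv\xi_2\pmod 1$ and $\xi_1\not\equiv-\xi_2\pmod 1$, and such that, if both $\xi_1$ and $\xi_2$ are rational, the pair of their (reduced) denominators, written with the larger denominator first, is none of $(5,5)$, $(6,3)$, $(8,4)$. Then for every $\bm{c}\in\mathbb{R}^2$ there is $\epsilon>0$ such that there are infinitely many $n\in\mathbb{N}$ with \[ n(\xi_1,\xi_2)\bmod 1\ \in\ \mathcal{S}_{1/4-\epsilon}(\bm{c})\bmod 1. \]
   Context: For $\bm{x}\in\mathbb{R}^2$, $\bm{x}\bmod 1$ is taken componentwise with values in $[0,1)$, and for a set $X\subseteq\mathbb{R}^2$, $X\bmod 1=\{\bm{x}\bmod 1:\bm{x}\in X\}$. For $\lambda>0$ and $\bm{c}=(c_1,c_2)\in\mathbb{R}^2$, $\mathcal{S}_\lambda(\bm{c})=\{\bm{x}\in\mathbb{R}^2:|x_1-c_1|<\lambda,\ |x_2-c_2|<\lambda\}$ is the open axis-parallel square of side length $2\lambda$ centred at $\bm{c}$. $\mathbb{N}$ includes $0$. *)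

(* Defs.v *)
From mathcomp Require Import all_boot all_order all_algebra.
From mathcomp Require Import all_classical all_reals.

Set Implicit Arguments.
Unset Strict Implicit.
Unset Printing Implicit Defensive.

Import Order.TTheory GRing.Theory Num.Theory.

Local Open Scope classical_set_scope.
Local Open Scope ring_scope.

Definition frac1 (R : realType) (x : R) : R := x - (Num.floor x)%:~R.

Definition mod1 {R : realType} (x : R * R) : R * R := (frac1 x.1, frac1 x.2).

(* Meant for lam > 0; the set is empty when lam <= 0. *)
Definition square (R : realType) (lam : R) (c : R * R) : set (R * R) :=
  [set x | `|x.1 - c.1| < lam /\ `|x.2 - c.2| < lam].

Definition eqmod1 (R : realType) (x y : R) : Prop :=
  exists k : int, x - y = k%:~R.

(* Since [denq q] is the positive denominator of [q] in lowest terms, this is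
   the pair of reduced denominators with the larger one first. *)
Definition denominators (q1 q2 : rat) : int * int :=
  (Num.max (denq q1) (denq q2), Num.min (denq q1) (denq q2)).

(* Main.v *)
(** The multiples of the point [xi = (xi1, xi2)] are compared with those of a
    rational point [p / N], where [N] is minimal with [N xi] close to an
    integer vector [p], so that [gcd(p1, p2, N) = 1].  The lattice
    [L = Z p/N + Z^2] has covolume [1 / N].  For [(a, b, m)] primitive with
    [a p1 + b p2 = m N], it lies on the lines [a x + b y = k], [k] an integer,
    and on each line its points are the translates of one of them by the
    multiples of [(b, -a) / N]: an open square of side 1/2 meets [L] as soon as
    it cuts a segment long enough on one of the lines.  The hypotheses on [xi]
    say that [|a| + |b| >= 3], and by pigeonhole [a, b] can be taken of size at
    most [sqrt N]; this suffices when [N >= 10].  If [N < 10], then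
    [xi = p / N], and going through the finitely many cases shows that the only
    bad ones are those excluded.  Squares of half-side 6/25 already meet [L], which
    leaves room for the error of the approximation and for [eps]; applying this
    to the centre [c - M xi] gives a multiple [n xi] with [n >= M]. *)
Require Import Defs.
From mathcomp Require Import all_boot all_order all_algebra.
From mathcomp Require Import all_classical all_reals.
From mathcomp Require Import ring lra zify.

Import Order.TTheory GRing.Theory Num.Theory.

Local Open Scope classical_set_scope.
Local Open Scope ring_scope.

(** * Lattice points in a square *)

(** For [A, B > 0] the admissible [l] lie between the larger of [(Y - h) / A], [(- h - X) / B] and
    the smaller of [(Y + h) / A], [(h - X) / B]. The hypotheses make each upper bound exceed each
    lower one by at least 1, so an integer fits. *)
Lemma line_meets_square_nneg (R : realType) (A B X Y h : R) :
  0 <= A -> 0 <= B -> 0 < A + B -> A <= 2 * h -> B <= 2 * h ->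
  `|A * X + B * Y| + A * B <= h * (A + B) ->
  exists l : int, `|X + l%:~R * B| <= h /\ `|Y - l%:~R * A| <= h.
Proof.
move=> A0 B0 AB Ah Bh; rewrite -lerBrDr ler_norml => /andP[lo hi].
pose rA := (Y - h) / A; pose rB := (- h - X) / B.
(* A zero coefficient is left out, since its quotient would be the default value 0. *)
pose u := if A == 0 then rB else if B == 0 then rA else Num.max rA rB.
exists (Num.ceil u).
have /andP[] := Num.Theory.ceil_itv u; rewrite intrB => u2 u1.
move: (Num.ceil u) u1 u2 => l; move: (l%:~R : R) => {}l; rewrite /u {u}.
have [A_0|An0] := eqVneq A 0.
  have Bp : 0 < B by lra.
  have rBE : rB * B = - h - X by rewrite /rB divfK ?gt_eqF.
  move=> u1 u2; move: lo hi; rewrite A_0 => lo hi.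
  have Yh : Y <= h by rewrite -(ler_pM2r Bp); lra.
  have hY : - h <= Y by rewrite -(ler_pM2r Bp); lra.
  have v' : (l - 1) * B < - h - X by rewrite -rBE ltr_pM2r.
  have uB' : - h - X <= l * B by rewrite -rBE ler_pM2r.
  rewrite !ler_norml; split; apply/andP; split; lra.
have Ap : 0 < A by rewrite lt_def An0.
have rAE : rA * A = Y - h by rewrite /rA divfK.
have [B_0|Bn0] := eqVneq B 0.
  move=> u1 u2; move: lo hi; rewrite B_0 => lo hi.
  have Xh : X <= h by rewrite -(ler_pM2r Ap); lra.
  have hX : - h <= X by rewrite -(ler_pM2r Ap); lra.
  have v' : (l - 1) * A < Y - h by rewrite -rAE ltr_pM2r.
  have uA' : Y - h <= l * A by rewrite -rAE ler_pM2r.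
  rewrite !ler_norml; split; apply/andP; split; lra.
have Bp : 0 < B by rewrite lt_def Bn0.
have rBE : rB * B = - h - X by rewrite /rB divfK.
rewrite ge_max => /andP[uA uB].
rewrite lt_max => /orP[v|v].
  have v' : (l - 1) * A < Y - h by rewrite -rAE ltr_pM2r.
  have uA' : Y - h <= l * A by rewrite -rAE ler_pM2r.
  have uB' : - h - X <= l * B by rewrite -rBE ler_pM2r.
  rewrite !ler_norml; split; apply/andP; split; nra.
have v' : (l - 1) * B < - h - X by rewrite -rBE ltr_pM2r.
have uA' : Y - h <= l * A by rewrite -rAE ler_pM2r.
have uB' : - h - X <= l * B by rewrite -rBE ler_pM2r.
rewrite !ler_norml; split; apply/andP; split; nra.
Qed.

Lemma line_meets_square (R : realType) (A B X Y h : R) :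
  0 < `|A| + `|B| -> `|A| <= 2 * h -> `|B| <= 2 * h ->
  `|A * X + B * Y| + `|A| * `|B| <= h * (`|A| + `|B|) ->
  exists l : int, `|X + l%:~R * B| <= h /\ `|Y - l%:~R * A| <= h.
Proof.
wlog A0 : A Y / 0 <= A => [th|].
  have [|A0] := leP 0 A; first exact: th.
  move=> AB Ah Bh ABh; have [|||||l [lX lY]] := th (- A) (- Y); rewrite ?normrN //.
  - by rewrite oppr_ge0 ltW.
  - by rewrite (_ : - A * X + B * - Y = - (A * X + B * Y)) ?normrN //; ring.
  by exists l; split=> //; rewrite -normrN (_ : - _ = - Y - l%:~R * - A) //; ring.
wlog B0 : B X / 0 <= B => [th|].
  have [|B0] := leP 0 B; first exact: th.
  move=> AB Ah Bh ABh; have [|||||l [lX lY]] := th (- B) (- X); rewrite ?normrN //.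
  - by rewrite oppr_ge0 ltW.
  - by rewrite (_ : A * - X + - B * Y = - (A * X + B * Y)) ?normrN //; ring.
  by exists l; split=> //; rewrite -normrN (_ : - _ = - X + l%:~R * - B) //; ring.
rewrite (ger0_norm A0) (ger0_norm B0); exact: line_meets_square_nneg.
Qed.

(* With [h = 6/25], the inequalities are those required by [line_meets_square]
   for [A = a/N], [B = b/N] on a line at [|a x + b y|] at most 1/2 from the
   centre of the square. *)
Definition good_relation (N p1 p2 : int) : Prop :=
  exists a b m : int,
    [/\ a * p1 + b * p2 = m * N, gcdz (gcdz a b) m = 1,
        25 * `|a| <= 12 * N, 25 * `|b| <= 12 * N &
        50 * (`|a| * `|b|) <= N * (12 * (`|a| + `|b|) - 25)].

(** Primitivity of [(a, b, m)] puts a lattice point on every line [a x + b y = k]; coprimality of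
    [(p1, p2, N)] puts [(b, -a) / N] in the lattice. The line used is the one nearest to the
    centre. *)
Lemma lattice_meets_square (R : realType) (N p1 p2 : int) (c1 c2 : R) :
  0 < N -> gcdz (gcdz p1 p2) N = 1 -> good_relation N p1 p2 ->
  exists j u1 u2 : int,
    `|j%:~R * (p1%:~R / N%:~R) + u1%:~R - c1| <= 6 / 25 /\
    `|j%:~R * (p2%:~R / N%:~R) + u2%:~R - c2| <= 6 / 25.
Proof.
move=> N0 cop [a [b [m [rel prim ha hb hab]]]].
have bez3 (x y z : int) : gcdz (gcdz x y) z = 1 ->
    exists u v w, u * x + v * y + w * z = 1.
  have [u [v uvE]] := Bezoutz x y; have [s [w swE]] := Bezoutz (gcdz x y) z.
  move=> g1; exists (s * u), (s * v), w; rewrite -g1 -swE -uvE; ring.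
have [al [be [ga pE]]] := bez3 _ _ _ cop.
have [x [y [z wE]]] := bez3 _ _ _ prim.
have NR0 : (0 : R) < N%:~R by rewrite ltr0z.
pose A : R := a%:~R / N%:~R; pose B : R := b%:~R / N%:~R.
pose P1 : R := p1%:~R / N%:~R; pose P2 : R := p2%:~R / N%:~R.
pose t : R := a%:~R * c1 + b%:~R * c2.
pose k : int := Num.floor (t + 1 / 2).
have kt : `|k%:~R - t| <= 1 / 2.
  have := Num.Theory.floor_le (t + 1 / 2); have := Num.Theory.floorD1_gt (t + 1 / 2).
  rewrite -/k intrD => k1 k2; rewrite ler_norml; apply/andP; split; lra.
have intRE (u v : int) : u = v -> u%:~R = v%:~R :> R by move=> ->.
have relR : a%:~R * P1 + b%:~R * P2 = m%:~R.
  have : a%:~R * p1%:~R + b%:~R * p2%:~R = m%:~R * N%:~R :> R.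
    by rewrite -!intrM -intrD rel.
  by rewrite /P1 /P2 !mulrA -mulrDl => ->; rewrite mulfK ?gt_eqF.
pose X := k%:~R * (z%:~R * P1 + x%:~R) - c1.
pose Y := k%:~R * (z%:~R * P2 + y%:~R) - c2.
have wR : x%:~R * a%:~R + y%:~R * b%:~R + z%:~R * m%:~R = 1 :> R.
  by rewrite -!intrM -!intrD wE.
(* [(X, Y)] is, relative to [c], a lattice point on the line
   [a x + b y = k]. *)
have XYE : A * X + B * Y = (k%:~R - t) / N%:~R.
  have -> : k%:~R = k%:~R * (x%:~R * a%:~R + y%:~R * b%:~R + z%:~R * m%:~R) :> R.
    by rewrite wR mulr1.
  by rewrite -relR /A /B /X /Y /t; ring.
have haR : 25 * `|a%:~R| <= 12 * N%:~R :> R.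
  by move: ha; rewrite -(ler_int R) !intrM intr_norm.
have hbR : 25 * `|b%:~R| <= 12 * N%:~R :> R.
  by move: hb; rewrite -(ler_int R) !intrM intr_norm.
have habR : 50 * (`|a%:~R| * `|b%:~R|) <=
    N%:~R * (12 * (`|a%:~R| + `|b%:~R|) - 25) :> R.
  by move: hab; rewrite -(ler_int R) !(intrM, intrD, intrB) !intr_norm.
have V0 : 0 < N%:~R^-1 :> R by rewrite invr_gt0.
have AE : `|A| = `|a%:~R| / N%:~R by rewrite normrM (gtr0_norm V0).
have BE : `|B| = `|b%:~R| / N%:~R by rewrite normrM (gtr0_norm V0).
have [||||l [lX lY]] := @line_meets_square R A B X Y (6 / 25).
- rewrite AE BE -mulrDl mulr_gt0 //.
  (* The left side of [habR] is nonnegative, which forces [|a| + |b| >= 25 / 12]. *)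
  have : 0 <= `|a%:~R| * `|b%:~R| :> R by rewrite mulr_ge0.
  move=> ab0; have := le_trans (mulr_ge0 (ler0n _ 50) ab0) habR.
  by rewrite pmulr_rge0 //; lra.
- by rewrite AE ler_pdivrMr //; lra.
- by rewrite BE ler_pdivrMr //; lra.
- rewrite XYE AE BE normrM (gtr0_norm V0).
  rewrite -(ler_pM2r NR0) -(ler_pM2r NR0).
  set n : R := N%:~R in NR0 haR hbR habR V0 *.
  set aa := `|a%:~R| in haR habR *; set bb := `|b%:~R| in hbR habR *.
  have -> : (`|k%:~R - t| / n + aa / n * (bb / n)) * n * n =
     `|k%:~R - t| * n + aa * bb by field; rewrite gt_eqF.
  have -> : 6 / 25 * (aa / n + bb / n) * n * n = 6 / 25 * (aa + bb) * n.
    by field; rewrite gt_eqF.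
  have : `|k%:~R - t| * n <= 1 / 2 * n by rewrite ler_pM2r.
  by lra.
(* [(b, -a) / N] belongs to the lattice spanned by [p / N] and [Z^2]. *)
have bE : B = (al * b - be * a)%:~R * P1 + (ga * b + be * m)%:~R.
  apply: (mulIf (lt0r_neq0 NR0)).
  rewrite mulrDl -[_ * P1 * _]mulrA /B /P1 !divfK ?gt_eqF // -!intrM -intrD; apply: intRE.
  (* [p2] is eliminated between the Bezout identity [pE] and the relation [rel]; for [aE], [p1] is
     eliminated likewise. *)
  transitivity (b * (al * p1 + be * p2 + ga * N) -
    be * (a * p1 + b * p2 - m * N)); last by ring.
  by rewrite pE rel; ring.
have aE : - A = (al * b - be * a)%:~R * P2 - (ga * a + al * m)%:~R.
  apply: (mulIf (lt0r_neq0 NR0)).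
  rewrite mulrBl -[_ * P2 * _]mulrA /A /P2 mulNr !divfK ?gt_eqF //.
  rewrite -!intrM -intrB -rmorphN; apply: intRE.
  transitivity (- a * (al * p1 + be * p2 + ga * N) +
    al * (a * p1 + b * p2 - m * N)); last by ring.
  by rewrite pE rel; ring.
exists (k * z + l * (al * b - be * a)), (k * x + l * (ga * b + be * m)),
  (k * y - l * (ga * a + al * m)).
rewrite -/P1 -/P2; split.
  rewrite (_ : _ - c1 = X + l%:~R * B) // bE /X !(intrD, intrM, intrB).
  by ring.
rewrite (_ : _ - c2 = Y - l%:~R * A) // -mulrN aE /Y !(intrD, intrM, intrB).
by ring.
Qed.

(** * Short integer relations modulo [N] *)

(** Among the [(s + 1)^2] pairs with entries in [[0, s]], two give the same value of the form modulo
    [N]; [(a, b)] is their difference. *)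
Lemma thue (N s : nat) (p1 p2 : int) : (0 < N < s.+1 * s.+1)%N ->
  exists a b : int, [/\ (a, b) != (0, 0), `|a| <= s%:Z, `|b| <= s%:Z &
    (N %| a * p1 + b * p2)%Z].
Proof.
move=> /andP[N0 Ns].
have fP (u : 'I_s.+1 * 'I_s.+1) :
    (`|((u.1%:Z * p1 + u.2%:Z * p2) %% N%:Z)%Z| < N)%N.
  have N0' : 0 < N%:Z by [].
  by have := ltz_pmod (u.1%:Z * p1 + u.2%:Z * p2) N0'; have := modz_ge0
    (u.1%:Z * p1 + u.2%:Z * p2) (lt0r_neq0 N0'); lia.
pose f u : 'I_N := Ordinal (fP u).
have /injectivePn[[u1 u2] [[v1 v2] uv fuv]] : ~~ injectiveb f.
  apply/negP => /injectiveP/leq_card.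
  by rewrite card_prod !card_ord leqNgt Ns.
exists (u1%:Z - v1%:Z), (u2%:Z - v2%:Z); split.
- apply: contra uv => /eqP[/eqP e1 /eqP e2]; apply/eqP; congr pair.
    by apply/val_inj => /=; lia.
  by apply/val_inj => /=; lia.
- by have := ltn_ord u1; have := ltn_ord v1; lia.
- by have := ltn_ord u2; have := ltn_ord v2; lia.
move: fuv => /(congr1 val) /= fuv.
have N0' : N%:Z != 0 by lia.
have /eqP : ((u1%:Z * p1 + u2%:Z * p2) %% N%:Z)%Z = ((v1%:Z * p1 + v2%:Z * p2) %% N%:Z)%Z.
  have := modz_ge0 (u1%:Z * p1 + u2%:Z * p2) N0'.
  by have := modz_ge0 (v1%:Z * p1 + v2%:Z * p2) N0'; lia.
rewrite eqz_mod_dvd; congr (_ %| _)%Z; ring.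
Qed.

(** The whole triple is divided by its gcd; a common factor of [a] and [b] alone need not divide
    [m]. *)
Lemma primitive_relation (N p1 p2 a b : int) : (a, b) != (0, 0) ->
  (N %| a * p1 + b * p2)%Z ->
  exists a' b' m : int, [/\ a' * p1 + b' * p2 = m * N,
    gcdz (gcdz a' b') m = 1, `|a'| <= `|a|, `|b'| <= `|b| & (a', b') != (0, 0)].
Proof.
move=> ab0 /dvdzP[m mE]; pose g := gcdz (gcdz a b) m.
have /dvdzP[m' m'E] : (g %| m)%Z by rewrite dvdz_gcdr.
have gg : (g %| gcdz a b)%Z by rewrite dvdz_gcdl.
have /dvdzP[a' a'E] : (g %| a)%Z by rewrite (dvdz_trans gg) ?dvdz_gcdl.
have /dvdzP[b' b'E] : (g %| b)%Z by rewrite (dvdz_trans gg) ?dvdz_gcdr.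
have g0 : 0 < g.
  rewrite lt_def andbT; apply: contra ab0 => /eqP g0.
  by rewrite a'E b'E g0 !mulr0.
have e : gcdz (gcdz a' b') m' = 1.
  apply: (mulIf (lt0r_neq0 g0)).
  have gE x y : gcdz x y * g = gcdz (x * g) (y * g).
    by rewrite -mulz_gcdl gtz0_abs.
  by rewrite !gE -a'E -b'E -m'E mul1r.
exists a', b', m'; split=> //.
- apply: (mulIf (lt0r_neq0 g0)); rewrite mulrAC -m'E -mE a'E b'E; ring.
- by rewrite a'E normrM ler_peMr // gtr0_norm //; lia.
- by rewrite b'E normrM ler_peMr // gtr0_norm //; lia.
by apply: contra ab0 => /eqP[a0 b0]; rewrite a'E b'E a0 b0 !mul0r.
Qed.

(** A nonzero [(a, b)] with [|a| + |b| <= 2] would make a coordinate of [p / N] an integer or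
    half-integer, or the sum or difference of the two an integer: the cases excluded for [xi]. *)
Definition no_short_relation (N p1 p2 : int) : Prop :=
  forall a b : int, (N %| a * p1 + b * p2)%Z ->
    a = 0 /\ b = 0 \/ 3 <= `|a| + `|b|.

Lemma good_relation_large (N p1 p2 : int) : 10 <= N ->
  no_short_relation N p1 p2 -> good_relation N p1 p2.
Proof.
case: N => // n n10 short.
have [s /andP[sn ns]] : exists s : nat, (s * s <= n < s.+1 * s.+1)%N.
  elim: n {n10 short} => [|n [s /andP[sn ns]]]; first by exists 0%N.
  have [h|h] := leqP (s.+1 * s.+1) n.+1; last by exists s; lia.
  by exists s.+1; lia.
have s3 : (3 <= s)%N by rewrite leqNgt; apply/negP => s2; nia.
have snZ : s%:Z * s%:Z <= n%:Z by lia.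
have bounds (A B : int) : 0 <= A -> 0 <= B -> 3 <= A + B -> A <= s%:Z ->
    B <= s%:Z -> [/\ 25 * A <= 12 * n%:Z, 25 * B <= 12 * n%:Z &
      50 * (A * B) <= n%:Z * (12 * (A + B) - 25)].
  move=> A0 B0 L3 As Bs; split; [nia|nia|].
  (* From sum 7 on, [12 * (A + B) - 25] is at least 59, so [A * B <= s^2 <= n] suffices. For sums 3,
     4, 5, 6 the product is at most 2, 4, 6, 9; sums 3 and 6 are what requires [n >= 10]. *)
  have [L7|L6] := leP 7 (A + B).
    have : A * B <= s%:Z * s%:Z by rewrite ler_pM.
    nia.
  have amgm : 4 * (A * B) <= (A + B) * (A + B).
    by have := sqr_ge0 (A - B); rewrite expr2; lia.
  have : A + B = 3 \/ A + B = 4 \/ A + B = 5 \/ A + B = 6 by lia.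
  by move=> [|[|[|]]] e; rewrite e in amgm *; lia.
have [|a0 [b0 [ab0 a0s b0s dvd0]]] := thue n s p1 p2; first by lia.
have [a [b [m [rel prim ha hb ab]]]] := primitive_relation _ _ _ _ _ ab0 dvd0.
have L3 : 3 <= `|a| + `|b|.
  case: (short a b) => [|[a_0 b_0]|//]; first by rewrite rel dvdz_mull.
  by rewrite a_0 b_0 in ab.
have {a0s}ha := le_trans ha a0s; have {b0s}hb := le_trans hb b0s.
have [] := bounds _ _ (normr_ge0 a) (normr_ge0 b) L3 ha hb.
by exists a, b, m.
Qed.

Lemma good_relation_small (n p q : nat) : (p < n < 10)%N -> (q < n)%N ->
  no_short_relation n p q ->
  denominators (p%:~R / n%:~R) (q%:~R / n%:~R) \notin [:: (5, 5); (6, 3); (8, 4)] ->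
  good_relation n p q.
Proof.
move=> /andP[pn n10] qn short den.
pose shorts : seq (int * int) :=
  [:: (1, 0); (0, 1); (2, 0); (0, 2); (1, 1); (1, -1)].
(* Entries 1 and 3 fit the size bounds from [n = 7] on, entries 1 and 4 only for [n = 9]; for
   [n <= 6] one of the first two alternatives of [test] always holds. *)
pose candidates : seq (int * int) :=
  [:: (1, 3); (3, 1); (1, -3); (3, -1); (1, 4); (4, 1); (1, -4); (4, -1)].
pose form (p q : nat) (w : int * int) := w.1 * p%:Z + w.2 * q%:Z.
pose good (n p q : nat) w := let m := (form p q w %/ n)%Z in
  [&& form p q w == m * n, gcdz (gcdz w.1 w.2) m == 1,
      25 * `|w.1| <= 12 * n%:Z, 25 * `|w.2| <= 12 * n%:Z &
      50 * (`|w.1| * `|w.2|) <= n%:Z * (12 * (`|w.1| + `|w.2|) - 25)].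
pose test (n p q : nat) :=
  [|| has (fun w => n %| form p q w)%Z shorts,
      denominators (p%:~R / n%:~R) (q%:~R / n%:~R)
        \in [:: (5, 5); (6, 3); (8, 4)] |
      has (good n p q) candidates].
have /allP/(_ n) : all (fun n => all (fun p => all (test n p) (iota 0 n))
    (iota 0 n)) (iota 0 10) by vm_compute.
rewrite mem_iota => /(_ n10)/allP/(_ p).
rewrite mem_iota => /(_ pn)/allP/(_ q).
rewrite mem_iota => /(_ qn)/or3P[/hasP[w wS /short]|/idPn//|].
  by move: wS; rewrite !inE => /or4P[|||/or3P[]] /eqP -> /=; lia.
by case/hasP => -[a b] _ /and5P[/eqP ? /eqP ? ? ? ?]; exists a, b, (form p q (a, b) %/ n)%Z.
Qed.

(** * Simultaneous approximation *)

Lemma int_eq_of_dist_lt1 (R : realType) (m n : int) :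
  `|m%:~R - n%:~R| < 1 :> R -> m = n.
Proof. by rewrite -intrB -intr_norm -[1]/(1%:~R) ltr_int => ?; lia. Qed.

(** A non-integer has a positive distance to the integers, an integer has distance at least 1 to the
    others, and [s] is finite. *)
Lemma near_integer_gap (R : realType) (s : seq R) :
  exists2 k : R, 0 < k &
    forall x, x \in s -> forall m : int, `|x - m%:~R| <= k -> x = m%:~R.
Proof.
elim: s => [|x s [k k0 sk]]; first by exists 1.
have [k1 k10 xk] : exists2 k1 : R, 0 < k1 &
    forall m : int, `|x - m%:~R| <= k1 -> x = m%:~R.
  have /andP[] := Num.Theory.floor_itv x.
  set f := Num.floor x; rewrite intrD => fx xf.
  have [fE|fN] := eqVneq (f%:~R : R) x.
    exists (1 / 2); first by lra.
    move=> m; rewrite -fE => fm; congr _%:~R.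
    by apply: (@int_eq_of_dist_lt1 R); apply: le_lt_trans fm _; lra.
  have {fN}fx : f%:~R < x by rewrite lt_neqAle fN.
  (* Halving makes the bounds strict: [m] would lie strictly between [f] and [f + 1]. *)
  exists (Num.min (x - f%:~R) (f%:~R + 1 - x) / 2).
    by rewrite divr_gt0 // lt_min; apply/andP; split; lra.
  move=> m; rewrite ler_norml => /andP[lo hi].
  have := ge_min (x - f%:~R) (x - f%:~R) (f%:~R + 1 - x).
  have := ge_min (f%:~R + 1 - x) (x - f%:~R) (f%:~R + 1 - x).
  rewrite !lexx orbT /= => h1 h2.
  have : m%:~R < (f + 1)%:~R :> R by rewrite intrD; lra.
  have : f%:~R < m%:~R :> R by lra.
  by rewrite !ltr_int => ? ?; lia.
exists (Num.min k k1); first by rewrite lt_min k0.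
move=> y; rewrite inE => /orP[/eqP ->|ys] m; rewrite le_min => /andP[h1 h2].
  exact: xk.
exact: sk.
Qed.

(** Dirichlet's argument: of the multiples with index from 0 to [K^2], two have fractional parts in
    the same of the [K^2] boxes of side [1 / K < k], and [n] is the difference of their indices. *)
Lemma dirichlet2 (R : realType) (x1 x2 k : R) : 0 < k ->
  exists n : nat, (0 < n)%N /\ exists p1 p2 : int,
    `|n%:R * x1 - p1%:~R| <= k /\ `|n%:R * x2 - p2%:~R| <= k.
Proof.
move=> k0; have [K kK] : exists K : nat, k^-1 < K%:R.
  by exists (Num.trunc k^-1).+1; exact: Num.Theory.truncnS_gt.
have K0 : 0 < K%:R :> R by apply: lt_trans kK; rewrite invr_gt0.
have frac01 (x : R) : 0 <= frac1 x < 1.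
  have /andP[] := Num.Theory.floor_itv x; rewrite intrD /frac1 => ? ?.
  by apply/andP; split; lra.
have boxP (x : R) : (Num.trunc (K%:R * frac1 x) < K)%N.
  have /andP[f0 f1] := frac01 x.
  rewrite Num.Theory.truncn_lt_nat; first by rewrite gtr_pMr.
  by rewrite mulr_ge0 // ltW.
pose f (n : 'I_(K * K).+1) : 'I_K * 'I_K :=
  (Ordinal (boxP (n%:R * x1)), Ordinal (boxP (n%:R * x2))).
have /injectivePn[u [v uv fuv]] : ~~ injectiveb f.
  apply/negP => /injectiveP/leq_card.
  by rewrite card_prod !card_ord ltnn.
wlog {uv} uv : u v fuv / (u < v)%N => [th|].
  move: uv; rewrite neq_lt => /orP[?|?]; first exact: (th u v).
  by apply: (th v u).
exists (v - u)%N; split; first by rewrite subn_gt0.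
have close x : Num.trunc (K%:R * frac1 (u%:R * x)) =
    Num.trunc (K%:R * frac1 (v%:R * x)) ->
    `|(v - u)%:R * x -
      (Num.floor (v%:R * x) - Num.floor (u%:R * x))%:~R| <= k.
  move=> e; rewrite natrB 1?ltnW // intrB.
  have -> : (v%:R - u%:R) * x - ((Num.floor (v%:R * x))%:~R -
     (Num.floor (u%:R * x))%:~R) = frac1 (v%:R * x) - frac1 (u%:R * x).
    by rewrite /frac1; ring.
  have /andP[a0 a1] := frac01 (v%:R * x); have /andP[b0 b1] := frac01 (u%:R * x).
  move: e; set a := frac1 (v%:R * x); set b := frac1 (u%:R * x) => e.
  have /andP[] := Num.Theory.truncn_itv (mulr_ge0 (ltW K0) a0).
  have /andP[] := Num.Theory.truncn_itv (mulr_ge0 (ltW K0) b0).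
  rewrite -/a -/b e -!natr1 => h1 h2 h3 h4.
  have kK1 : 1 < K%:R * k by rewrite -ltr_pdivrMr // div1r.
  rewrite -(ler_pM2l K0) -[K%:R in X in X <= _]gtr0_norm // -normrM ler_norml.
  by apply/andP; split; lra.
exists (Num.floor (v%:R * x1) - Num.floor (u%:R * x1)),
  (Num.floor (v%:R * x2) - Num.floor (u%:R * x2)).
by case: fuv => e1 e2; split; apply: close.
Qed.

(** For minimal [n], a common factor [g > 1] of [p1], [p2], [n] is impossible: dividing it out also
    divides the errors by [g]. *)
Lemma coprime_approximation (R : realType) (x1 x2 k : R) : 0 < k ->
  exists (n : nat) (p1 p2 : int), [/\ (0 < n)%N, gcdz (gcdz p1 p2) n = 1,
    `|n%:R * x1 - p1%:~R| <= k & `|n%:R * x2 - p2%:~R| <= k].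
Proof.
move=> k0.
pose approx n := (0 < n)%N /\ exists p1 p2 : int,
  `|n%:R * x1 - p1%:~R| <= k /\ `|n%:R * x2 - p2%:~R| <= k.
have [|n /asboolP[n0 [p1 [p2 [h1 h2]]]] nmin] := @ex_minnP (fun n => `[< approx n >]).
  by have [n ?] := dirichlet2 _ x1 x2 _ k0; exists n; apply/asboolP.
exists n, p1, p2; split=> //.
pose g := gcdz (gcdz p1 p2) n.
have gg : (g %| gcdz p1 p2)%Z by rewrite dvdz_gcdl.
have /dvdzP[q1 q1E] : (g %| p1)%Z by rewrite (dvdz_trans gg) ?dvdz_gcdl.
have /dvdzP[q2 q2E] : (g %| p2)%Z by rewrite (dvdz_trans gg) ?dvdz_gcdr.
have /dvdzP[m mE] : (g %| n%:Z)%Z by rewrite dvdz_gcdr.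
have g0 : 0 <= g by [].
rewrite -/g; case: m g g0 mE q1E q2E {gg} => [m|m] [g|g] // _ mE q1E q2E; last by lia.
have {mE}nE : n = (m * g)%N by lia.
have gpos : (0 < g)%N by lia.
have gR : 1 <= g%:R :> R by rewrite ler1n.
have close (x : R) p q : p = q * g%:Z -> `|n%:R * x - p%:~R| <= k ->
    `|m%:R * x - q%:~R| <= k.
  move=> ->; rewrite nE natrM intrM -[g%:~R]/(g%:R).
  have -> : m%:R * g%:R * x - q%:~R * g%:R = g%:R * (m%:R * x - q%:~R) by ring.
  rewrite normrM ger0_norm ?ler0n //; apply: le_trans.
  by rewrite ler_peMl.
have : (n <= m)%N.
  apply: nmin; apply/asboolP; split; first by lia.
  by exists q1, q2; split; [exact: close h1 | exact: close h2].
by move=> nm; suff -> : g = 1%N by []; nia.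
Qed.

(** * Relations for [xi] and infinitely many multiples *)

Lemma infinite_nat_unbounded (A : set nat) :
  (forall M : nat, exists2 n : nat, (M <= n)%N & A n) -> infinite_set A.
Proof.
move=> unb /finite_seqP[s sE].
have [n nM An] := unb (\max_(i <- s) i).+1.
have ns : n \in s by move: An; rewrite sE.
by have := @leq_bigmax_seq _ s xpredT id n ns isT; rewrite leqNgt nM.
Qed.

Lemma frac1Dz (R : realType) (x : R) (m : int) : frac1 (x + m%:~R) = frac1 x.
Proof.
by rewrite /frac1 Num.Theory.floorDrz // Num.Theory.intrKfloor intrD; ring.
Qed.

(** A nonzero [a] would make [2 * x] an integer strictly between 0 and 2, hence 1. *)
Lemma small_multiple_eq0 (R : realType) (x : R) (a m : int) : 0 < x < 1 ->
  x <> 1 / 2 -> `|a| <= 2 -> a%:~R * x = m%:~R -> a = 0.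
Proof.
move=> /andP[x0 x1] x2 a2 axm.
have [k kE] : exists k : int, 2 * x = k%:~R \/ a = 0.
  have [a0|[a1|[a1|[a1|a1]]]] : a = 0 \/ a = 1 \/ a = -1 \/ a = 2 \/ a = - 2 by lia.
  - by exists 0; right.
  - by exists (2 * m); left; rewrite intrM -axm a1; ring.
  - by exists (- 2 * m); left; rewrite intrM -axm a1; ring.
  - by exists m; left; rewrite -axm a1.
  - by exists (- m); left; rewrite intrN -axm a1; ring.
case: kE => // kE; case: x2.
have k0 : 0 < k by rewrite -(ltr_int R) -kE; lra.
have k2 : k < 2 by rewrite -(ltr_int R) -kE; lra.
have k1 : k = 1 by lia.
by move: kE; rewrite k1; lra.
Qed.

Lemma no_short_real_relation (R : realType) (xi1 xi2 : R) (a b m : int) :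
  0 < xi1 < 1 -> xi1 <> 1 / 2 -> 0 < xi2 < 1 -> xi2 <> 1 / 2 ->
  ~ eqmod1 xi1 xi2 -> ~ eqmod1 xi1 (- xi2) ->
  `|a| + `|b| <= 2 -> a%:~R * xi1 + b%:~R * xi2 = m%:~R -> a = 0 /\ b = 0.
Proof.
move=> x1 x1h x2 x2h xx xNx ab rel.
have [a0|an0] := eqVneq a 0.
  split=> //; apply: (@small_multiple_eq0 R xi2 b m) => //; first by lia.
  by rewrite -rel a0 mul0r add0r.
have [b0|bn0] := eqVneq b 0.
  suff : a = 0 by [].
  apply: (@small_multiple_eq0 R xi1 a m) => //; first by lia.
  by rewrite -rel b0 mul0r addr0.
have : a = 1 \/ a = -1 by lia.
have : b = 1 \/ b = -1 by lia.
case=> bE [] aE; move: rel; rewrite aE bE => rel.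
- by case: xNx; exists m; rewrite -rel; ring.
- by case: xx; exists (- m); rewrite intrN -rel; ring.
- by case: xx; exists m; rewrite -rel; ring.
- by case: xNx; exists (- m); rewrite intrN -rel; ring.
Qed.

Lemma good_approximation (R : realType) (xi1 xi2 : R)
  (xi1_01 : 0 < xi1 < 1) (xi1_half : xi1 <> 1 / 2)
  (xi2_01 : 0 < xi2 < 1) (xi2_half : xi2 <> 1 / 2)
  (xi_neq : ~ eqmod1 xi1 xi2) (xi_neqN : ~ eqmod1 xi1 (- xi2))
  (xi_den : forall q1 q2 : rat, xi1 = ratr q1 -> xi2 = ratr q2 ->
     denominators q1 q2 \notin [:: (5, 5); (6, 3); (8, 4)]) :
  exists (N : nat) (p1 p2 : int),
    [/\ (0 < N)%N, gcdz (gcdz p1 p2) N = 1, good_relation N p1 p2,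
        `|N%:R * xi1 - p1%:~R| <= 1 / 200 & `|N%:R * xi2 - p2%:~R| <= 1 / 200].
Proof.
pose I : seq int := [:: -2; -1; 0; 1; 2].
(* A short relation between [p1], [p2] modulo [N], or [N < 10], forces one of
   these reals to be close to an integer, hence to be equal to it. *)
have [k k0 gap] := near_integer_gap _
  ([seq n%:R * xi1 | n <- iota 0 10] ++ [seq n%:R * xi2 | n <- iota 0 10] ++
   [seq a%:~R * xi1 + b%:~R * xi2 | a <- I, b <- I]).
(* [k] is halved because a short relation combines the two errors with total weight
   [|a| + |b| <= 2]. *)
pose kap := Num.min (k / 2) (1 / 200).
have kap0 : 0 < kap by rewrite lt_min; apply/andP; split; lra.
have kap1 : kap <= k / 2 by rewrite ge_min lexx.
have kap2 : kap <= 1 / 200 by rewrite ge_min lexx orbT.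
have [N [p1 [p2 [N0 cop h1 h2]]]] := coprime_approximation _ xi1 xi2 _ kap0.
have NR : 1 <= N%:R :> R by rewrite ler1n.
exists N, p1, p2; split=> //; [|exact: le_trans h1 kap2|exact: le_trans h2 kap2].
have short : no_short_relation N p1 p2.
  move=> a b /dvdzP[m rel].
  have [|ab] := leP 3 (`|a| + `|b|); first by right.
  have {}ab : `|a| + `|b| <= 2 by lia.
  left; apply: (@no_short_real_relation R xi1 xi2 a b m) => //.
  have relR : a%:~R * p1%:~R + b%:~R * p2%:~R = m%:~R * N%:R :> R.
    by rewrite -[N%:R]/(N%:~R) -!intrM -intrD rel.
  apply: gap.
    rewrite mem_cat; apply/orP; right; rewrite mem_cat; apply/orP; right.
    by apply/allpairsP; exists (a, b); split=> //; rewrite !inE /=; lia.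
  have abR : `|a%:~R| + `|b%:~R| <= 2 :> R.
    by move: ab; rewrite -(ler_int R) intrD !intr_norm.
  rewrite -(ler_pM2l (lt_le_trans ltr01 NR)).
  rewrite -[N%:R in X in X <= _]ger0_norm ?ler0n // -normrM.
  have -> : N%:R * (a%:~R * xi1 + b%:~R * xi2 - m%:~R) =
      a%:~R * (N%:R * xi1 - p1%:~R) + b%:~R * (N%:R * xi2 - p2%:~R).
    by rewrite !mulrBr mulrDr [N%:R * m%:~R]mulrC -relR; ring.
  apply: le_trans (ler_normD _ _) _; rewrite !normrM.
  have := ler_wpM2l (normr_ge0 (a%:~R : R)) h1.
  have := ler_wpM2l (normr_ge0 (b%:~R : R)) h2.
  have : 0 <= (2 - (`|a%:~R| + `|b%:~R|)) * kap by rewrite mulr_ge0 ?(ltW kap0) //; lra.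
  have : 0 <= (N%:R - 1) * k by rewrite mulr_ge0 ?(ltW k0) //; lra.
  lra.
have [N10|N10] := leqP 10 N; first exact: good_relation_large.
have N1 : N%:R != 0 :> R by rewrite pnatr_eq0; lia.
have rational (xi : R) (p : int) : 0 < xi < 1 -> N%:R * xi = p%:~R ->
    exists2 q : nat, p = q & (q < N)%N /\ xi = ratr (p%:~R / N%:~R).
  move=> /andP[x0 x1] e.
  have p0 : 0 < p by rewrite -(ltr_int R) -e mulr_gt0 // ltr0n.
  have pN : p < N by rewrite -(ltr_int R) -e -[N%:~R]/(N%:R) gtr_pMr // ltr0n.
  case: p e p0 pN => // q e p0 pN; exists q => //; split=> //.
  by rewrite fmorph_div /= !ratr_int -e mulrC mulKf.
have e1 : N%:R * xi1 = p1%:~R.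
  apply: gap; last by apply: le_trans h1 _; lra.
  rewrite mem_cat; apply/orP; left.
  by apply: (map_f (fun n : nat => n%:R * xi1)); rewrite mem_iota.
have e2 : N%:R * xi2 = p2%:~R.
  apply: gap; last by apply: le_trans h2 _; lra.
  rewrite mem_cat; apply/orP; right; rewrite mem_cat; apply/orP; left.
  by apply: (map_f (fun n : nat => n%:R * xi2)); rewrite mem_iota.
have [q1 q1E [q1N x1E]] := rational _ _ xi1_01 e1.
have [q2 q2E [q2N x2E]] := rational _ _ xi2_01 e2.
have den := xi_den _ _ x1E x2E.
rewrite q1E q2E in short den *.
by apply: good_relation_small => //; rewrite q1N.
Qed.

Theorem theorem2p2 (R : realType) (xi1 xi2 : R)
  (xi1_01 : 0 < xi1 < 1) (xi1_half : xi1 <> 1 / 2)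
  (xi2_01 : 0 < xi2 < 1) (xi2_half : xi2 <> 1 / 2)
  (xi_neq : ~ eqmod1 xi1 xi2) (xi_neqN : ~ eqmod1 xi1 (- xi2))
  (xi_den : forall q1 q2 : rat, xi1 = ratr q1 -> xi2 = ratr q2 ->
     denominators q1 q2 \notin [:: (5, 5); (6, 3); (8, 4)]) :
  forall c : R * R, exists2 eps : R, 0 < eps &
    infinite_set [set n : nat |
      (mod1 @` square (1 / 4 - eps) c) (mod1 (n%:R * xi1, n%:R * xi2))].
Proof.
(* The lattice bound and the approximation error add up to [6 / 25 + 1 / 200 = 0.245], below
   [1 / 4 - 1 / 250 = 0.246]. *)
move=> c; exists (1 / 250); first by lra.
have [N [p1 [p2 [N0 cop good h1 h2]]]] :=
  good_approximation R xi1 xi2 xi1_01 xi1_half xi2_01 xi2_half xi_neq xi_neqN xi_den.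
apply: infinite_nat_unbounded => M.
have N0' : 0 < N%:Z by [].
have [j [u1 [u2 [l1 l2]]]] := lattice_meets_square R N p1 p2
  (c.1 - M%:R * xi1) (c.2 - M%:R * xi2) N0' cop good.
(* Replacing [j] by its remainder [r] modulo [N] moves [j p / N] by an integer vector, and since
   [r < N] the error [r (xi - p / N)] stays within [1 / 200]. *)
have r0 := modz_ge0 j (lt0r_neq0 N0'); have rN := ltz_pmod j N0'.
have jE := divz_eq j N.
move: (j %/ N)%Z (j %% N)%Z jE r0 rN => q [r|//] jE _ rN.
have NR0 : 0 < N%:R :> R by rewrite ltr0n.
have orbit (xi x : R) (p u : int) : `|N%:R * xi - p%:~R| <= 1 / 200 ->
    `|j%:~R * (p%:~R / N%:~R) + u%:~R - (x - M%:R * xi)| <= 6 / 25 ->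
    `|(M + r)%:R * xi + (u + q * p)%:~R - x| < 1 / 4 - 1 / 250.
  move=> close; rewrite jE !intrD !intrM natrD.
  rewrite -[(Posz r)%:~R]/(r%:R) -[(Posz N)%:~R]/(N%:R) => near.
  have -> : (M%:R + r%:R) * xi + (u%:~R + q%:~R * p%:~R) - x =
     ((q%:~R * N%:R + r%:R) * (p%:~R / N%:R) + u%:~R - (x - M%:R * xi)) +
     r%:R / N%:R * (N%:R * xi - p%:~R).
    by field; rewrite gt_eqF.
  apply: le_lt_trans (ler_normD _ _) _.
  have rN1 : r%:R / N%:R <= 1 :> R by rewrite ler_pdivrMr // mul1r ler_nat ltnW.
  have : `|r%:R / N%:R * (N%:R * xi - p%:~R)| <= 1 / 200.
    rewrite normrM ger0_norm ?divr_ge0 ?ler0n //.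
    by apply: le_trans close; rewrite ler_piMl.
  by lra.
exists (M + r)%N; first exact: leq_addr.
exists ((M + r)%:R * xi1 + (u1 + q * p1)%:~R, (M + r)%:R * xi2 + (u2 + q * p2)%:~R).
  by split; exact: orbit.
by rewrite /mod1 /= !frac1Dz.
Qed.
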